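(* Let $T$ be a complex algebraic torus and let $V$ be a finite-dimensional $T$-module. Let $\alpha_1,\dots,\alpha_n$ be the nonzero weights of $V$. Then $V$ is coreduced if and only if the solutions $(m_1,\dots,m_n)\in\mathbb{N}^n$ of $$\sum_{i=1}^n m_i\alpha_i=0,\qquad m_i\in\mathbb{N},$$ are generated (as an additive monoid) by solutions in which every $m_i$ is zero or one.
   Context: $\mathbb{N}=\{0,1,2,\dots\}$. For a complex reductive group $G$ and a finite-dimensional rational $G$-module $V$, $\mathcal{O}(V)$ denotes the ring of polynomial functions on $V$, $\pi\colon V\to V/\!\!/G$ is the categorical quotient (dual to $\mathcal{O}(V)^G\subset\mathcal{O}(V)$), and $\mathcal{N}(V)=\pi^{-1}(\pi(0))$ is the null cone. $V$ is called coreduced if the scheme-theoretic fiber $\pi^{-1}(\pi(0))$ is reduced, i.e. if the ideal $I(\mathcal{N}(V))\subset\mathcal{O}(V)$ of functions vanishing on $\mathcal{N}(V)$ is generated by the homogeneous maximal ideal $\mathfrak{m}_0\subset\mathcal{O}(V)^G$ of invariants vanishing at $0$. Here these notions are applied with $G=T$. *)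

(* Defs.v *)
From HB Require Import structures.
From mathcomp Require Import all_boot all_order all_algebra.
From mathcomp Require Import mpoly complex reals.

Set Implicit Arguments.
Unset Strict Implicit.
Unset Printing Implicit Defensive.

Import GRing.Theory.
Local Open Scope ring_scope.

(* Varieties are represented by their points together with their functions,
   so these definitions have their usual meaning over an algebraically closed
   field F; they are used with F = R[i], the complex numbers. *)

(* [regular] is the coordinate ring of T.  The last field says that T is
   isomorphic, as an algebraic group, to the group GL_1(F)^r of points with
   nonzero coordinates, whose coordinate ring is F[x_1..x_r][1/(x_1...x_r)]. *)
Record algTorus (F : fieldType) := AlgTorus {
  torus_group :> groupType;
  regular : (torus_group -> F) -> Prop;
  torus_split : exists (r : nat) (phi : torus_group -> {ffun 'I_r -> F}),
    [/\ injective phi,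
        forall z, (exists t, phi t = z) <-> (forall i, z i != 0),
        forall s t i, phi (s * t)%g i = phi s i * phi t i
      & forall f, regular f <->
          exists (p : {mpoly F[r]}) (k : nat),
            forall t, f t = p.@[phi t] / (\prod_i phi t i) ^+ k]
}.

(* Rationality: all matrix coefficients t |-> l (t v) are regular. *)
Record ratModule (F : fieldType) (T : algTorus F) (V : vectType F) := RatModule {
  act :> T -> 'End(V);
  act1 : forall v, act 1%g v = v;
  actM : forall s t v, act (s * t)%g v = act s (act t v);
  act_rational : forall (l : 'Hom(V, F^o)) (v : V),
    regular (fun t => l (act t v) : F)
}.

(* The character group X(T); its additive notation in the literature stands
   for pointwise multiplication of nowhere vanishing functions on T. *)
Definition is_character (F : fieldType) (T : algTorus F) (chi : T -> F) : Prop :=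
  [/\ regular chi, chi 1%g = 1
    & forall s t, chi (s * t)%g = chi s * chi t].

Definition is_weight (F : fieldType) (T : algTorus F) (V : vectType F)
    (rho : ratModule T V) (chi : T -> F) : Prop :=
  is_character chi /\
  exists2 v : V, v != 0 & forall t, rho t v = chi t *: v.

(* "Nonzero" refers to X(T) written additively: chi is not identically 1. *)
Definition is_nonzero_weight (F : fieldType) (T : algTorus F) (V : vectType F)
    (rho : ratModule T V) (chi : T -> F) : Prop :=
  is_weight rho chi /\ exists t, chi t != 1.

(* O(V), as a ring of functions on V. *)
Definition polynomial_function (F : fieldType) (V : vectType F) (f : V -> F) : Prop :=
  exists p : {mpoly F[\dim {:V}]},
    forall v, f v = p.@[fun i => coord (vbasis {:V}) i v].

Definition invariant_function (F : fieldType) (T : algTorus F) (V : vectType F)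
    (rho : ratModule T V) (f : V -> F) : Prop :=
  polynomial_function f /\ forall t v, f (rho t v) = f v.

(* pi v = pi w in V//T; a point of V//T is the maximal ideal of O(V)^T of the
   invariants vanishing there, so it is determined by the values of the
   invariants. *)
Definition same_quotient_point (F : fieldType) (T : algTorus F) (V : vectType F)
    (rho : ratModule T V) (v w : V) : Prop :=
  forall f, invariant_function rho f -> f v = f w.

Definition null_cone (F : fieldType) (T : algTorus F) (V : vectType F)
    (rho : ratModule T V) (v : V) : Prop :=
  same_quotient_point rho v 0.

Definition ideal_null_cone (F : fieldType) (T : algTorus F) (V : vectType F)
    (rho : ratModule T V) (f : V -> F) : Prop :=
  polynomial_function f /\ forall v, null_cone rho v -> f v = 0.

Definition inv_max_ideal (F : fieldType) (T : algTorus F) (V : vectType F)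
    (rho : ratModule T V) (f : V -> F) : Prop :=
  invariant_function rho f /\ f 0 = 0.

Definition generated_ideal (F : fieldType) (V : vectType F)
    (S : (V -> F) -> Prop) (f : V -> F) : Prop :=
  exists (k : nat) (a g : 'I_k -> V -> F),
    [/\ forall j, polynomial_function (a j),
        forall j, S (g j)
      & forall v, f v = \sum_(j < k) a j v * g j v].

Definition coreduced (F : fieldType) (T : algTorus F) (V : vectType F)
    (rho : ratModule T V) : Prop :=
  forall f, ideal_null_cone rho f <-> generated_ideal (inv_max_ideal rho) f.

(* alpha_1, ..., alpha_n lists exactly the nonzero weights; repetitions are
   allowed, so that both the list without repetition and the list with
   multiplicities dim V_alpha are covered. *)
Definition lists_nonzero_weights (F : fieldType) (T : algTorus F) (V : vectType F)
    (rho : ratModule T V) (n : nat) (alpha : 'I_n -> T -> F) : Prop :=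
  forall chi, is_nonzero_weight rho chi <-> exists i, alpha i =1 chi.

(* m_1 alpha_1 + ... + m_n alpha_n = 0 in X(T). *)
Definition weight_solution (F : fieldType) (T : algTorus F) (n : nat)
    (alpha : 'I_n -> T -> F) (m : 'I_n -> nat) : Prop :=
  forall t, \prod_(i < n) alpha i t ^+ m i = 1.

Definition generated_by_01_solutions (F : fieldType) (T : algTorus F) (n : nat)
    (alpha : 'I_n -> T -> F) : Prop :=
  forall m, weight_solution alpha m ->
    exists (k : nat) (s : 'I_k -> 'I_n -> nat),
      (forall j, weight_solution alpha (s j) /\ (forall i, (s j i <= 1)%N)) /\
      (forall i, m i = (\sum_(j < k) s j i)%N).

(* Main.v *)
Require Import Defs.
From mathcomp Require Import all_boot all_order all_algebra.
From mathcomp Require Import mpoly complex reals.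
From mathcomp Require Import boolp.

(* Pick a basis of weight vectors, with weights chi_j.  An invariant polynomial
   is then a combination of invariant monomials, i.e. of monomials x^m with
   sum m_j chi_j = 0, and the null cone
   is the union of the coordinate subspaces whose support contains the
   support of no nonconstant invariant monomial.  A polynomial vanishes on it
   iff the support of each of its monomials contains the support of some
   nonconstant invariant monomial.  Comparing the two monomial ideals, V is
   coreduced iff below every nonzero solution m there is a nonzero solution with
   entries 0 and 1: apply coreducedness to the squarefree part of x^m, which
   vanishes on the null cone.  Subtracting such solutions one at a time
   generates m.  Zero weights only contribute coordinates that are themselves
   invariant, and repetitions among the weights do not affect the condition. *)

Set Implicit Arguments.
Unset Strict Implicit.
Unset Printing Implicit Defensive.

Import GRing.Theory Num.Theory.
Local Open Scope ring_scope.

(** * Monomials with exponents indexed by a finite type *)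

Definition monomial (F : fieldType) (I : finType) (x : I -> F) (m : I -> nat) : F :=
  \prod_i x i ^+ m i.

Section Monomials.
Variables (F : fieldType) (I : finType).
Implicit Types (x y : I -> F) (m : I -> nat).

Lemma eq_monomial x y m : x =1 y -> monomial x m = monomial y m.
Proof. by move=> xy; apply: eq_bigr => i _; rewrite xy. Qed.

Lemma eq_monomialr x m m' : m =1 m' -> monomial x m = monomial x m'.
Proof. by move=> mm'; apply: eq_bigr => i _; rewrite mm'. Qed.

Lemma monomialM x y m :
  monomial (fun i => x i * y i) m = monomial x m * monomial y m.
Proof. by rewrite -big_split /=; apply: eq_bigr => i _; rewrite exprMn. Qed.

Lemma monomialD x m m' :
  monomial x (fun i => m i + m' i)%N = monomial x m * monomial x m'.
Proof. by rewrite -big_split /=; apply: eq_bigr => i _; rewrite exprD. Qed.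

Lemma monomial0 x : monomial x (fun=> 0%N) = 1.
Proof. by rewrite /monomial big1. Qed.

Lemma monomial1x m : monomial (fun=> 1 : F) m = 1.
Proof. by rewrite /monomial big1 // => i _; rewrite expr1n. Qed.

Lemma monomial_eq0 x m :
  reflect (exists2 i, x i = 0 & (0 < m i)%N) (monomial x m == 0).
Proof.
apply: (iffP (prodf_eq0 _ _)) => [[i _]|[i xi mi]].
  by rewrite expf_eq0 => /andP[mi /eqP]; exists i.
by exists i => //; rewrite expf_eq0 mi xi eqxx.
Qed.

(** The factors on the right are grouped by the fibres of [f]. This is what transports relations
    between index sets. *)
Lemma monomial_reindex (J : finType) (x : I -> F) (f : J -> I) (m : J -> nat) :
  monomial x (fun i => \sum_(j | f j == i) m j)%N = monomial (fun j => x (f j)) m.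
Proof.
rewrite /monomial [RHS](partition_big f xpredT) //=.
apply: eq_bigr => i _; rewrite -prodrXr.
by apply: eq_bigr => j /eqP ->.
Qed.

End Monomials.

(** * Linear independence of monomials at points with nonzero coordinates *)

Section Independence.
Variables (F : numFieldType) (r : nat).

(* Artin's argument: doubling the coordinate where two exponents differ
   multiplies the two monomials by distinct scalars. *)
Lemma monomials_independent (V : lmodType F) (s : seq 'X_{1..r})
    (c : 'X_{1..r} -> V) :
  uniq s ->
  (forall x : 'I_r -> F, (forall i, x i != 0) ->
     \sum_(a <- s) monomial x a *: c a = 0) ->
  forall a, a \in s -> c a = 0.
Proof.
elim: s c => [|m s IH] c //= /andP[ms us] H.
have cs a : a \in s -> c a = 0.
  move=> as_.
  have /existsP[i mai] : [exists i, m i != a i].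
    rewrite -negb_forall; apply: contraNN ms => /forallP ma.
    by have /mnmP -> // : m =1 a by move=> i; apply/eqP.
  (* Subtracting the identity at the doubled point from [2 ^+ m i] times the identity at [x] cancels
     the term of [m] and rescales the other coefficients in this way. *)
  have := IH (fun b => (2 ^+ m i - 2 ^+ b i) *: c b) us _ a as_ => /(_ _)/eqP.
  rewrite scaler_eq0 subr_eq0 => /(_ _)/orP[x x0||/eqP//].
    pose y j := (if j == i then 2 else 1) * x j.
    have y0 j : y j != 0.
      by rewrite mulf_neq0 //; case: ifP; rewrite ?oner_neq0 ?pnatr_eq0.
    have yE b : monomial y b = 2 ^+ b i * monomial x b.
      rewrite monomialM; congr (_ * _).
      rewrite /monomial (bigD1 i) //= eqxx big1 ?mulr1 // => j /negPf ->.
      by rewrite expr1n.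
    have := H y y0; have := H x x0; rewrite !big_cons => Hx Hy.
    have -> : \sum_(b <- s) monomial x b *: ((2 ^+ m i - 2 ^+ b i) *: c b)
       = 2 ^+ m i *: (\sum_(b <- s) monomial x b *: c b)
         - \sum_(b <- s) monomial y b *: c b.
      rewrite scaler_sumr -sumrB; apply: eq_bigr => b _.
      by rewrite yE !scalerA -scalerBl mulrBr mulrC [X in _ - X]mulrC.
    move/eqP: Hx; rewrite addrC addr_eq0 => /eqP ->.
    move/eqP: Hy; rewrite addrC addr_eq0 => /eqP ->.
    by rewrite yE scalerN scalerA opprK addNr.
  by rewrite (inj_eq (ieexprIn _ _)) ?ltr0n ?pnatr_eq1 // (negPf mai).
move=> a; rewrite inE => /predU1P[->|]; last exact: cs.
have := H (fun=> 1) (fun=> oner_neq0 F); rewrite big_cons big_seq big1.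
  by rewrite monomial1x scale1r addr0.
by move=> b bs; rewrite cs ?scaler0.
Qed.

(** Serves to expand several polynomials over one common list of exponents, or to force an exponent
    into the list. *)
Lemma mevalE_subset (p : {mpoly F[r]}) (s : seq 'X_{1..r}) (x : 'I_r -> F) :
  uniq s -> {subset msupp p <= s} -> p.@[x] = \sum_(a <- s) p@_a * monomial x a.
Proof.
move=> us sub; rewrite mevalE [RHS](bigID (mem (msupp p))) /= [X in _ + X]big1 ?addr0.
  rewrite -[RHS]big_filter; apply: perm_big; apply: uniq_perm => //.
    exact: filter_uniq.
  move=> a; rewrite mem_filter; case ap: (a \in msupp p) => //=.
  by rewrite sub.
by move=> a; rewrite mcoeff_msupp negbK => /eqP ->; rewrite mul0r.
Qed.

Lemma meval_inj_torus (p q : {mpoly F[r]}) :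
  (forall x : 'I_r -> F, (forall i, x i != 0) -> p.@[x] = q.@[x]) -> p = q.
Proof.
move=> H; apply/eqP; rewrite -subr_eq0; apply/eqP/mpolyP => a; rewrite mcoeff0.
case: (boolP (a \in msupp (p - q))) => [|/memN_msupp_eq0//].
apply: (@monomials_independent F^o _ (fun a => (p - q)@_a)) => // x x0.
have /eqP := H x x0; rewrite -subr_eq0 -mevalB mevalE => /eqP {2}<-.
by apply: eq_bigr => b _; rewrite [RHS]mulrC.
Qed.

End Independence.

(** * Relations among characters and the descent by 0/1 solutions *)

Section CharacterRelations.
Variables (F : fieldType) (T : Type).

Definition char_relation (I : finType) (kappa : I -> T -> F) (m : I -> nat) :=
  forall t, monomial (kappa^~ t) m = 1.

(* One step of the descent that writes m as a sum of 0/1 solutions; unlike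
   generation itself, it transfers along changes of the index set. *)
Definition dominates_01 (I : finType) (kappa : I -> T -> F) :=
  forall m, char_relation kappa m -> (exists i, 0 < m i)%N ->
  exists s, [/\ char_relation kappa s, exists i, (0 < s i)%N,
                forall i, (s i <= 1)%N & forall i, (s i <= m i)%N].

(** A relation on [J] is pushed to [I] by summing over the fibres of [f] and dominated there; the
    0/1 solution found is then lifted back to [J]. *)
Lemma dominates_01_reindex (I J : finType) (kappa : I -> T -> F)
    (lambda : J -> T -> F) :
  (forall j, exists i, kappa i =1 lambda j) ->
  dominates_01 kappa -> dominates_01 lambda.
Proof.
move=> /fin_all_exists[f fE] dom m rel_m [j0 mj0].
pose M i := (\sum_(j | f j == i) m j)%N.
have rel_reindex k :
    char_relation kappa (fun i => \sum_(j | f j == i) k j)%N <-> char_relation lambda k.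
  by split=> rel_k t; rewrite -(rel_k t) monomial_reindex;
     apply: eq_monomial => j; rewrite fE.
have [|s [rel_s [i1 si1] s1 sM]] := dom M ((rel_reindex m).2 rel_m).
  by exists (f j0); rewrite /M (bigD1 j0) //= addn_gt0 mj0.
have pickE i : (0 < s i)%N -> exists2 j, f j = i & (0 < m j)%N.
  move=> si; have : (0 < M i)%N by apply: leq_trans si (sM i).
  by rewrite lt0n sum_nat_eq0 negb_forall => /existsP[j];
     rewrite negb_imply -lt0n => /andP[/eqP]; exists j.
(* To lift [s], each fibre puts its whole value on a single index where [m] is positive. The result
   keeps entries 0 and 1, stays below [m], and has fibre sums [s]. *)
pose g i := [pick j | (f j == i) && (0 < m j)%N].
pose u j := if g (f j) == Some j then s (f j) else 0%N.
have uE i : (\sum_(j | f j == i) u j)%N = s i.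
  rewrite /u; have [si0|/pickE[j fj mj]] := posnP (s i).
    by rewrite si0 big1 // => j /eqP ->; rewrite si0 if_same.
  have : g i != None by rewrite /g; case: pickP => // /(_ j); rewrite fj eqxx mj.
  case gi : (g i) => [k|//] _.
  have fk : f k = i by move: gi; rewrite /g; case: pickP => // x /andP[/eqP + _] [<-].
  rewrite (bigD1 k) ?fk //= gi eqxx big1 ?addn0 // => l /andP[/eqP-> lk].
  by rewrite gi; case: eqP => // -[kl]; rewrite kl eqxx in lk.
exists u; split.
- by apply/rel_reindex => t; rewrite -(rel_s t); apply: eq_monomialr.
- move: si1; rewrite -uE lt0n sum_nat_eq0 negb_forall => /existsP[j].
  by rewrite negb_imply -lt0n => /andP[_]; exists j.
- by move=> j; rewrite /u; case: ifP.
- move=> j; rewrite /u; case: ifP => // /eqP; rewrite /g.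
  by case: pickP => // k /andP[_ mk] [kj]; rewrite kj in mk; apply: leq_trans mk.
Qed.

(** [None] stands for an added zero weight. If [m] is positive there, the indicator of [None] is
    already a solution; otherwise [m] lives on [I]. *)
Lemma dominates_01_option (I : finType) (kappa : I -> T -> F) :
  dominates_01 kappa -> dominates_01 (fun o => oapp kappa (fun=> 1) o).
Proof.
move=> dom m rel_m m_gt0.
have relE k : (char_relation (fun o => oapp kappa (fun=> 1) o) k)
    <-> char_relation kappa (k \o Some).
  have kE t : monomial ((fun o => oapp kappa (fun=> 1) o)^~ t) k
      = monomial (kappa^~ t) (k \o Some).
    rewrite /monomial (bigD1 None) //= expr1n mul1r.
    rewrite (reindex_omap Some id) /=; last by case.
    by apply: eq_bigl => i; rewrite eqxx.
  by split=> rel_k t;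
     [exact: etrans (esym (kE t)) (rel_k t)|exact: etrans (kE t) (rel_k t)].
have [m0|mN] := posnP (m None); last first.
  exists (fun o => (o == None) : nat); split.
  - by apply/relE => t; apply: monomial0.
  - by exists None.
  - by case.
  - by case=> [i|] //=.
have [|s [rel_s [i si] s1 sm]] := dom _ ((relE m).1 rel_m).
  by case: m_gt0 => -[i mi|]; [exists i|rewrite m0].
exists (oapp s 0%N); split; first exact/relE.
- by exists (Some i).
- by case=> [j|] /=.
- by case=> [j|] /=.
Qed.

(** Forwards, a dominated 0/1 solution is subtracted, by induction on the sum of the entries of [m].
    Backwards, any summand that is positive where [m] is will do. *)
Lemma dominates_01P (n : nat) (alpha : 'I_n -> T -> F) :
  dominates_01 alpha <->
  forall m, char_relation alpha m ->
    exists (k : nat) (s : 'I_k -> 'I_n -> nat),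
      (forall j, char_relation alpha (s j) /\ (forall i, (s j i <= 1)%N)) /\
      (forall i, m i = (\sum_(j < k) s j i)%N).
Proof.
split=> [dom m|gen m rel_m [i mi]]; last first.
  have [k [s [rel_s mE]]] := gen m rel_m.
  have /existsP[j sj] : [exists j, 0 < s j i]%N.
    move: mi; rewrite mE lt0n sum_nat_eq0 negb_forall => /existsP[j].
    by rewrite /= -lt0n => ?; apply/existsP; exists j.
  exists (s j); split; [exact: (rel_s j).1|by exists i|exact: (rel_s j).2|].
  by move=> l; rewrite mE (bigD1 j) //= leq_addr.
have [N] := ubnP (\sum_i m i); elim: N m => // N IH m; rewrite ltnS => mN rel_m.
have [/existsP m_gt0|] := boolP [exists i, 0 < m i]%N; last first.
  rewrite negb_exists => /forallP m0.
  exists 0%N, (fun _ _ => 0%N); split=> [[]//|i].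
  by rewrite big_ord0; have := m0 i; rewrite -eqn0Ngt => /eqP.
have [s [rel_s [i si] s1 sm]] := dom m rel_m m_gt0.
have mE l : (m l = s l + (m l - s l))%N by rewrite subnKC.
have [||k [u [rel_u uE]]] := IH (fun l => m l - s l)%N.
- apply: leq_trans mN; rewrite [X in (_ < X)%N](eq_bigr _ (fun l _ => mE l)).
  by rewrite big_split /= -addn1 addnC leq_add2r (bigD1 i) //= addn_gt0 si.
- move=> t; rewrite -(rel_m t) (eq_monomialr _ mE) monomialD.
  by rewrite (rel_s t) mul1r.
exists k.+1, (fun j => oapp u s (unlift ord0 j)); split.
  by move=> j; case: unliftP => [j' _|_] /=.
move=> l; rewrite mE big_ord_recl unlift_none /= uE; congr addn.
by apply: eq_bigr => j _; rewrite liftK.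
Qed.

End CharacterRelations.

(** * Existence of a basis of weight vectors *)

Lemma exists_basis_in_span (F : fieldType) (V : vectType F) (X : seq V) :
  exists Y : seq V, {subset Y <= X} /\ basis_of <<X>>%VS Y.
Proof.
elim: X => [|x X [Y [YX bY]]]; first by exists [::]; rewrite span_nil nil_basis.
have spanY : <<Y>>%VS = <<X>>%VS by apply/eqP; case/andP: bY.
have [xX|xX] := boolP (x \in <<X>>%VS).
  exists Y; split=> [y yY|]; first by rewrite inE YX ?orbT.
  by rewrite span_cons (addv_idPr _) // -memvE.
exists (x :: Y); split=> [y|].
  by rewrite !inE => /orP[->//|/YX ->]; rewrite orbT.
by rewrite /basis_of !span_cons spanY eqxx free_cons spanY xX (basis_free bY).
Qed.

Section WeightBasis.
Variables (F : numFieldType) (T : algTorus F) (V : vectType F).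
Variable rho : ratModule T V.

(** Since [w] is nonzero, the scalars are determined by their action on it, so they inherit the laws
    of an action. *)
Lemma weight_is_character (chi : T -> F) (w : V) :
  w != 0 -> regular chi -> (forall t, rho t w = chi t *: w) ->
  is_character chi.
Proof.
move=> w0 reg_chi rho_w.
have inj a b : a *: w = b *: w -> a = b.
  by move/eqP; rewrite -subr_eq0 -scalerBl scaler_eq0 (negPf w0) orbF subr_eq0
    => /eqP.
split=> // [|s t]; apply: inj; first by rewrite -rho_w act1 scale1r.
by rewrite -rho_w actM rho_w linearZ /= rho_w scalerA mulrC.
Qed.

(* After clearing denominators, [rho t v] is a polynomial in [t] with
   coefficients in [V]; comparing coefficients in [rho (s t) v = rho s (rho t v)]
   shows that each coefficient is a weight vector, and [t = 1] recovers [v]. *)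
Lemma span_weight_vectors (v : V) :
  exists2 X : seq V, v \in <<X>>%VS &
    forall w, w \in X ->
      exists2 chi : T -> F, regular chi & forall t, rho t w = chi t *: w.
Proof.
have [r [phi [_ phi_onto phiM regE]]] := torus_split T.
pose N := \dim {:V}; pose b := vbasis {:V}.
have /fin_all_exists2[p] (i : 'I_N) :
    exists2 p : {mpoly F[r]}, True & exists k : nat,
    forall t, coord b i (rho t v) = p.@[phi t] / (\prod_i phi t i) ^+ k.
  have [p [k pk]] := (regE _).1 (act_rational rho (linfun (coord b i : V -> F^o)) v).
  by exists p => //; exists k => t; rewrite -pk lfunE.
move=> _ /fin_all_exists[k pk].
pose D t := \prod_i phi t i; pose K := (\sum_i k i)%N.
have phi0 t i : phi t i != 0 by move: i; apply/phi_onto; exists t.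
have D0 t : D t != 0 by apply/prodf_neq0 => i _.
have DM s t : D (s * t)%g = D s * D t.
  by rewrite -big_split; apply: eq_bigr => i _; rewrite phiM.
(* All coordinates of [rho t v] are brought to the common denominator [D t ^+ K]; [K] bounds every
   [k i], being their sum. *)
pose q i := p i * (\prod_j 'X_j) ^+ (K - k i).
pose s := undup (flatten [seq msupp (q i) | i : 'I_N]).
pose c a : V := \sum_i (q i)@_a *: b`_i.
have rhoE t : rho t v = (D t ^- K) *: \sum_(a <- s) monomial (phi t) a *: c a.
  rewrite (coord_vbasis (memvf (rho t v))).
  under [in RHS]eq_bigr do rewrite scaler_sumr.
  rewrite exchange_big scaler_sumr; apply: eq_bigr => i _ /=.
  under [in RHS]eq_bigr do rewrite scalerA mulrC.
  rewrite -scaler_suml scalerA -/b; congr (_ *: _).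
  rewrite -mevalE_subset ?undup_uniq //; last first.
    move=> a aq; rewrite mem_undup; apply/flattenP.
    by exists (msupp (q i)) => //; apply: map_f; rewrite mem_enum.
  rewrite mevalM rmorphXn rmorph_prod /=.
  under [X in _ * X ^+ _]eq_bigr do rewrite mevalXU.
  rewrite -/(D t) pk -/(D t) [RHS]mulrC -mulrA; congr (_ * _).
  have kK : (k i <= K)%N by rewrite /K (bigD1 i) //= leq_addr.
  by rewrite expfB_cond ?(negPf (D0 t)) // [RHS]mulrC mulKf ?expf_neq0.
have c_weight a : a \in s ->
    forall t, rho t (c a) = (monomial (phi t) a / D t ^+ K) *: c a.
  move=> as_ t.
  (* With [t] fixed, the action law is an identity in [u], and [phi u] runs over all points with
     nonzero coordinates; independence kills each defect [d a]. *)
  pose d a := rho t (c a) - (monomial (phi t) a / D t ^+ K) *: c a.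
  apply/eqP; rewrite -subr_eq0; apply/eqP; move: a as_.
  apply: (@monomials_independent _ _ _ s d); first exact: undup_uniq.
  move=> x x0.
  have [u phiu] : exists u, phi u = finfun x.
    by apply/phi_onto => i; rewrite ffunE.
  have /eqP : rho t (\sum_(a <- s) monomial (phi u) a *: c a)
      = D t ^- K *: \sum_(a <- s) monomial (phi (t * u)%g) a *: c a.
    apply: (scalerI (invr_neq0 (expf_neq0 K (D0 u)))).
    by rewrite -linearZ /= -rhoE -actM rhoE DM exprMn invfM mulrC scalerA.
  rewrite -subr_eq0 linear_sum /= scaler_sumr -sumrB => /eqP E0; rewrite -[RHS]E0.
  apply: eq_bigr => a _; rewrite /d scalerBr [rho t (_ *: _)]linearZ /= !scalerA.
  rewrite (eq_monomial a (y := phi u)); last by move=> i; rewrite phiu ffunE.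
  rewrite (eq_monomial a (x := phi (t * u)%g) (phiM t u)) monomialM.
  by congr (_ - _ *: _); rewrite [RHS]mulrC mulrA [X in X / _]mulrC.
exists [seq c a | a <- s].
  rewrite -[v](act1 rho) rhoE memvZ //; rewrite big_seq memv_suml // => a as_.
  by rewrite memvZ // memv_span // map_f.
move=> _ /mapP[a as_ ->]; exists (fun t => monomial (phi t) a / D t ^+ K).
  by apply/regE; exists 'X_[a], K => t; rewrite mevalX.
exact: c_weight.
Qed.

Lemma exists_weight_basis :
  exists (e : (\dim {:V}).-tuple V) (chi : 'I_(\dim {:V}) -> T -> F),
    [/\ basis_of fullv e, forall j, is_character (chi j)
      & forall (j : 'I_(\dim {:V})) t, rho t e`_j = chi j t *: e`_j].
Proof.
have /fin_all_exists2[X Xspan Xweight] (i : 'I_(\dim {:V})) :=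
  span_weight_vectors (vbasis {:V})`_i.
pose Z := flatten [seq X i | i : 'I_(\dim {:V})].
have [Y [YZ bY]] := exists_basis_in_span Z.
have Zfull : <<Z>>%VS = fullv.
  apply/eqP; rewrite eqEsubv subvf -(span_basis (vbasisP fullv)); apply/span_subvP.
  move=> _ /(nthP 0)[i + <-]; rewrite size_tuple => iN.
  have := Xspan (Ordinal iN); apply: subvP; apply: sub_span => w wX.
  apply/flattenP; exists (X (Ordinal iN)) => //.
  by apply: map_f; rewrite mem_enum.
rewrite Zfull in bY.
have sY : size Y == \dim {:V} by rewrite eq_sym -(span_basis bY); exact: basis_free bY.
have /fin_all_exists2[chi regchi chiE] (j : 'I_(\dim {:V})) : exists2 chi : T -> F,
    regular chi & forall t, rho t Y`_j = chi t *: Y`_j.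
  have : Y`_j \in Y by rewrite mem_nth // (eqP sY).
  by move/YZ/flattenP => [_ /mapP[i _ ->]] /Xweight.
exists (Tuple sY), chi; split=> // j.
apply: (weight_is_character (w := Y`_j)) => //.
by apply: (basis_not0 bY); rewrite mem_nth ?(eqP sY).
Qed.

End WeightBasis.

(** * Polynomial functions, constant terms and generated ideals *)

Lemma polynomial_change_basis (F : fieldType) (V : vectType F) (n k : nat)
    (b : n.-tuple V) (e : k.-tuple V) (f : V -> F) :
  basis_of fullv e ->
  (exists p : {mpoly F[n]}, forall v, f v = p.@[fun i => coord b i v]) ->
  exists p : {mpoly F[k]}, forall v, f v = p.@[fun i => coord e i v].
Proof.
move=> be [p fE].
exists (p \mPo [tuple \sum_(j < k) coord b i e`_j *: 'X_j | i < n]) => v.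
rewrite fE comp_mpoly_meval; apply: meval_eq => i.
rewrite tnth_mktuple {1}(coord_basis be (memvf v)) linear_sum raddf_sum /=.
by apply: eq_bigr => j _; rewrite linearZ /= mevalZ mevalXU mulrC.
Qed.

(** Applied to invariants at the origin and at points of the null cone, where only the constant term
    survives. *)
Lemma meval_const (F : numFieldType) (n : nat) (q : {mpoly F[n]}) (x : 'I_n -> F) :
  (forall a, a \in msupp q -> a != 0%MM -> monomial x a = 0) -> q.@[x] = q@_0.
Proof.
move=> H; pose s := undup (0%MM :: msupp q).
(* The zero exponent is added to the list so that its term can be split off even when its
   coefficient is zero. *)
rewrite (@mevalE_subset _ _ _ s) ?undup_uniq //; last first.
  by move=> a aq; rewrite mem_undup inE aq orbT.
rewrite (bigD1_seq 0%MM) ?undup_uniq ?mem_undup ?mem_head //=.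
rewrite (eq_monomialr _ (m' := fun=> 0%N)); last by move=> i; rewrite mnm0E.
rewrite monomial0 mulr1 big1 ?addr0 // => a a0.
have [aq|/memN_msupp_eq0 ->] := boolP (a \in msupp q); last by rewrite mul0r.
by rewrite H // mulr0.
Qed.

Section PolynomialFunctions.
Variables (F : fieldType) (V : vectType F).
Implicit Types f g : V -> F.

Lemma polynomial_functionM f g : polynomial_function f -> polynomial_function g ->
  polynomial_function (fun v => f v * g v).
Proof. by move=> [p pE] [q qE]; exists (p * q) => v; rewrite mevalM pE qE. Qed.

Lemma polynomial_function_sum (I : finType) (f : I -> V -> F) :
  (forall i, polynomial_function (f i)) ->
  polynomial_function (fun v => \sum_i f i v).
Proof.
move=> /fin_all_exists[p pE]; exists (\sum_i p i) => v.
by rewrite raddf_sum; apply: eq_bigr => i _; rewrite pE.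
Qed.

Lemma generated_ideal_sum (I : eqType) (s : seq I) (S : (V -> F) -> Prop)
    (f : I -> V -> F) :
  (forall i, i \in s -> exists a g, [/\ polynomial_function a, S g
      & forall v, f i v = a v * g v]) ->
  generated_ideal S (fun v => \sum_(i <- s) f i v).
Proof.
elim: s => [|i s IH] H.
  exists 0%N, (fun _ _ => 0), (fun _ _ => 0).
  by split=> [[]//|[]//|v]; rewrite big_nil big_ord0.
have [|k [a [g [pa Sg fE]]]] := IH.
  by move=> j js; apply: H; rewrite inE js orbT.
have [a0 [g0 [pa0 Sg0 fE0]]] := H i (mem_head _ _).
exists k.+1, (fun j => oapp a a0 (unlift ord0 j)),
  (fun j => oapp g g0 (unlift ord0 j)).
split=> [j|j|v]; try by case: unliftP => [j' _|_] /=.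
rewrite big_cons big_ord_recl !unlift_none /= fE0 fE; congr (_ + _).
by apply: eq_bigr => j _; rewrite !liftK.
Qed.

End PolynomialFunctions.

(** * The null cone and coreducedness in weight coordinates *)

Section Coordinates.
Variables (F : numFieldType) (T : algTorus F) (V : vectType F).
Variables (rho : ratModule T V) (e : (\dim {:V}).-tuple V).
Variable chi : 'I_(\dim {:V}) -> T -> F.
Hypothesis e_basis : basis_of fullv e.
Hypothesis rho_e : forall (j : 'I_(\dim {:V})) t, rho t e`_j = chi j t *: e`_j.

Let crd (v : V) : 'I_(\dim {:V}) -> F := fun i => coord e i v.
Let pt (x : 'I_(\dim {:V}) -> F) : V := \sum_i x i *: e`_i.

Let crd_pt x : crd (pt x) =1 x.
Proof. by move=> i; rewrite /crd /pt coord_sum_free ?(basis_free e_basis). Qed.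

Let pt_crd v : pt (crd v) = v.
Proof. exact/esym/(coord_basis e_basis)/memvf. Qed.

Let crd_rho t v i : crd (rho t v) i = chi i t * crd v i.
Proof.
rewrite -{1}(pt_crd v) /pt linear_sum /= -(crd_pt (fun j => chi j t * crd v j) i).
congr (crd _ _); apply: eq_bigr => j _.
by rewrite linearZ /= rho_e scalerA mulrC.
Qed.

Let polynomialP f : polynomial_function f <->
  exists p : {mpoly F[\dim {:V}]}, forall v, f v = p.@[crd v].
Proof.
by split; apply: polynomial_change_basis; [exact: e_basis|exact: vbasisP].
Qed.

Let mnm_of (m : 'I_(\dim {:V}) -> nat) : 'X_{1..\dim {:V}} := [multinom m i | i < _].

Let polynomial_monomial m : polynomial_function (fun v => monomial (crd v) m).
Proof.
apply/polynomialP; exists 'X_[mnm_of m] => v.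
by rewrite mevalX; apply: eq_bigr => i _; rewrite mnmE.
Qed.

Let invariant_monomial m :
  char_relation chi m -> invariant_function rho (fun v => monomial (crd v) m).
Proof.
move=> rel_m; split=> // t v.
rewrite (eq_monomial m (y := fun i => chi i t * crd v i)); last exact: crd_rho.
by rewrite monomialM (rel_m t) mul1r.
Qed.

(** Acting by [t] multiplies each monomial by a scalar; by independence, invariance forces that
    scalar to be 1 wherever the coefficient is nonzero. *)
Let invariant_msupp (q : {mpoly F[\dim {:V}]}) f :
  invariant_function rho f -> (forall v, f v = q.@[crd v]) ->
  forall a, a \in msupp q -> char_relation chi a.
Proof.
move=> [_ f_inv] fE a aq t.
have : q@_a * (monomial (chi^~ t) a - 1) = 0; last first.
  move/eqP; rewrite mulf_eq0 subr_eq0; rewrite mcoeff_msupp in aq.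
  by rewrite (negPf aq) => /eqP.
pose c b : F^o := q@_b * (monomial (chi^~ t) b - 1).
apply: (@monomials_independent F _ F^o (msupp q) c) => // x _.
have /eqP := f_inv t (pt x); rewrite -subr_eq0 !fE => /eqP E0; rewrite -[RHS]E0.
rewrite (meval_eq _ (crd_pt x)) !mevalE -sumrB; apply: eq_bigr => b _.
have -> : \prod_i crd (rho t (pt x)) i ^+ b i
    = monomial (chi^~ t) b * monomial x b.
  rewrite -monomialM; apply: eq_monomial => i /=.
  by rewrite crd_rho crd_pt.
by rewrite /c /GRing.scale /= mulrC -mulrA mulrBl mul1r mulrBr.
Qed.

Let mnm_gt0 (a : 'X_{1..\dim {:V}}) : a != 0%MM -> exists i, (0 < a i)%N.
Proof.
move=> a0; apply/existsP; apply: contraNT a0; rewrite negb_exists => /forallP H.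
by apply/eqP/mnmP => i; rewrite mnm0E; apply/eqP; rewrite -leqn0 leqNgt.
Qed.

(** If all nonconstant invariant monomials vanish at [v], every invariant takes there its constant
    term, which is its value at 0. *)
Let null_coneP v : null_cone rho v <->
  forall m, char_relation chi m -> (exists i, 0 < m i)%N -> monomial (crd v) m = 0.
Proof.
have crd0 m : (exists i, 0 < m i)%N -> monomial (crd 0) m = 0.
  by move=> [i mi]; apply/eqP/monomial_eq0; exists i; rewrite // /crd linear0.
split=> [null_v m rel_m m_gt0|H f f_inv].
  by rewrite (null_v _ (invariant_monomial rel_m)) crd0.
have [q qE] := (polynomialP f).1 f_inv.1.
rewrite !qE !meval_const // => a aq /mnm_gt0 a_gt0; first exact: crd0.
exact: H (invariant_msupp f_inv qE aq) a_gt0.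
Qed.

(** The squarefree part of the monomial of [m] vanishes on the null cone, hence is a combination of
    invariants vanishing at 0. It must occur in one product [p j * q j], so a monomial [c] of the
    invariant [q j] divides it. *)
Lemma coreduced_dominates_01 : coreduced rho -> dominates_01 chi.
Proof.
move=> cored m rel_m m_gt0; pose r i : nat := (0 < m i)%N.
pose f v := monomial (crd v) r.
have : ideal_null_cone rho f.
  split=> [|v /null_coneP/(_ m rel_m m_gt0)/eqP/monomial_eq0[i xi mi]].
    exact: polynomial_monomial.
  by apply/eqP/monomial_eq0; exists i; rewrite // /r mi.
move=> /cored[k [a [g [pa ig fE]]]].
have /fin_all_exists[p pE] j := (polynomialP (a j)).1 (pa j).
have /fin_all_exists[q qE] j := (polynomialP (g j)).1 (ig j).1.1.
have X_r : 'X_[mnm_of r] = \sum_j p j * q j :> {mpoly F[\dim {:V}]}.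
  apply: meval_inj_torus => x _.
  rewrite -(meval_eq _ (crd_pt x)) -[RHS](meval_eq _ (crd_pt x)).
  rewrite raddf_sum mevalX /=.
  transitivity (f (pt x)); first by apply: eq_bigr => i _; rewrite mnmE.
  by rewrite fE; apply: eq_bigr => j _; rewrite mevalM pE qE.
have [j rj] : exists j, mnm_of r \in msupp (p j * q j).
  apply/existsP; apply: contraT; rewrite negb_exists => /forallP H.
  have /eqP := congr1 (mcoeff (mnm_of r)) X_r.
  rewrite mcoeffX eqxx raddf_sum big1 ?oner_eq0 // => j _.
  exact: memN_msupp_eq0.
have /allpairsP[[b c] /= [_ cq rE]] := msuppM_le rj.
have cr i : (c i <= r i)%N.
  have /mnmP/(_ i) := rE; rewrite mnmE mnmDE => ->; exact: leq_addl.
exists c; split.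
- by apply: (invariant_msupp (ig j).1 (qE j)).
(* [c] is not constant: [g j] vanishes at 0, so [q j] has no constant term. *)
- apply: mnm_gt0; apply: contraTneq cq => ->.
  have := (ig j).2; rewrite qE meval_const ?mcoeff_msupp => [->|c' _ /mnm_gt0[i ci]].
    by rewrite eqxx.
  by apply/eqP/monomial_eq0; exists i; rewrite // /crd linear0.
- by move=> i; apply: leq_trans (cr i) (leq_b1 _).
- by move=> i; apply: leq_trans (cr i) _; rewrite /r; case: (m i).
Qed.

(* If no invariant monomial is supported on the support of [a], the coordinate
   subspace of that support lies in the null cone, so [p] restricts to zero there. *)
Let vanishing_msupp (p : {mpoly F[\dim {:V}]}) (a : 'X_{1..\dim {:V}}) :
  (forall v, null_cone rho v -> p.@[crd v] = 0) -> a \in msupp p ->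
  exists m, [/\ char_relation chi m, exists i, (0 < m i)%N
    & forall i, (0 < m i)%N -> (0 < a i)%N].
Proof.
move=> p0 ap; apply: contrapT => no_m.
suff : p@_a = 0 by apply/eqP; rewrite -mcoeff_msupp.
pose inS (b : 'X_{1..\dim {:V}}) := [forall i, (0 < b i) ==> (0 < a i)]%N.
pose c b : F^o := if inS b then p@_b else 0.
have <- : c a = p@_a.
  by rewrite /c ifT //; apply/forallP => i; rewrite implybb.
apply: (@monomials_independent F _ F^o (msupp p) c) => // x x0.
(* At the truncated point [y], the monomials in [inS] keep their value at [x] and the others vanish;
   independence is thus applied at [x], whose coordinates are all nonzero. *)
pose y i := if (0 < a i)%N then x i else 0.
rewrite -[RHS](p0 (pt y)).
  rewrite (meval_eq _ (crd_pt y)) mevalE; apply: eq_bigr => b _.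
  rewrite -/(monomial y b) /c; case: ifPn => [/forallP bS|].
    rewrite /GRing.scale /= mulrC; congr (_ * _); apply: eq_bigr => i _.
    have := bS i; rewrite /y; case: (a i) => [|//].
    by rewrite /= implybF -eqn0Ngt => /eqP ->; rewrite !expr0.
  rewrite negb_forall => /existsP[l]; rewrite negb_imply => /andP[bl al].
  suff -> : monomial y b = 0 by rewrite scaler0 mulr0.
  by apply/eqP/monomial_eq0; exists l; rewrite // /y (negPf al).
apply/null_coneP => m rel_m m_gt0; apply: contrapT => /eqP.
rewrite (eq_monomial m (crd_pt y)) => ym; apply: no_m; exists m; split=> // i mi.
apply: contraNT ym => ai; apply/monomial_eq0; exists i => //.
by rewrite /y (negPf ai).
Qed.

(** A function vanishing on the null cone is treated monomial by monomial: each support contains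
    that of a nonzero solution, hence that of a 0/1 solution [s], and the invariant monomial of [s]
    divides. *)
Lemma dominates_01_coreduced : dominates_01 chi -> coreduced rho.
Proof.
move=> dom f; split=> [[f_poly f0]|[k [a [g [pa ig fE]]]]]; last first.
  split=> [|v null_v].
    have [p pE] := polynomial_function_sum
      (fun j => polynomial_functionM (pa j) (ig j).1.1).
    by exists p => v; rewrite fE pE.
  by rewrite fE big1 // => j _; rewrite (null_v _ (ig j).1) (ig j).2 mulr0.
have [p pE] := (polynomialP f).1 f_poly.
suff [k [a [g [pa ig sE]]]] : generated_ideal (inv_max_ideal rho)
    (fun v => \sum_(b <- msupp p) p@_b * monomial (crd v) b).
  by exists k, a, g; split=> // v; rewrite -sE pE mevalE.
apply: generated_ideal_sum => b bp.
have [|m [rel_m m_gt0 mb]] := vanishing_msupp _ bp.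
  by move=> v; rewrite -pE; apply: f0.
have [s [rel_s [i si] s1 sm]] := dom m rel_m m_gt0.
(* The truncated subtraction is exact: where [s l] is nonzero it equals 1, and then [m l], hence
   [b l], is positive. *)
have sb l : b l = (b l - s l + s l)%N.
  rewrite subnK //; have := sm l; have := mb l; have := s1 l.
  by case: (s l) => [|[|//]] // _ bl /bl.
exists (fun v => p@_b * monomial (crd v) (fun l => b l - s l)%N),
       (fun v => monomial (crd v) s); split=> [|| v].
- have [q qE] := polynomial_monomial (fun l => b l - s l)%N.
  by exists (p@_b *: q) => v; rewrite mevalZ qE.
- split; first exact: invariant_monomial.
  by apply/eqP/monomial_eq0; exists i; rewrite // /crd linear0.
- by rewrite (eq_monomialr _ sb) monomialD mulrA.
Qed.

Lemma weight_in_basis (w : V) (alpha : T -> F) :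
  w != 0 -> (forall t, rho t w = alpha t *: w) -> exists j, chi j =1 alpha.
Proof.
move=> w0 rho_w.
have /existsP[j wj] : [exists j, crd w j != 0].
  apply: contraNT w0; rewrite negb_exists => /forallP H.
  rewrite -(pt_crd w) /pt big1 // => j _.
  by have /negbNE/eqP -> := H j; rewrite scale0r.
exists j => t; apply: (mulIf wj); rewrite -crd_rho rho_w.
by rewrite /crd linearZ.
Qed.

End Coordinates.

(** * From the weights of the basis to the listed nonzero weights *)

Lemma coreduced_iff_generated_by_01 (F : numFieldType) (T : algTorus F)
    (V : vectType F) (rho : ratModule T V) (n : nat) (alpha : 'I_n -> T -> F) :
  lists_nonzero_weights rho alpha ->
  coreduced rho <-> generated_by_01_solutions alpha.
Proof.
move=> alphaP; have [e [chi [e_basis chi_char rho_e]]] := exists_weight_basis rho.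
apply: iff_trans (dominates_01P alpha).
split=> [cored|dom].
  apply: dominates_01_reindex (coreduced_dominates_01 e_basis rho_e cored) => i.
  have [[_ [w w0 rho_w]] _] := (alphaP (alpha i)).2 (ex_intro _ i (frefl _)).
  by have [j jP] := weight_in_basis e_basis rho_e w0 rho_w; exists j.
apply: (dominates_01_coreduced e_basis rho_e).
(* Basis vectors of trivial weight are sent to [None], the others to an index of their weight in
   [alpha]. *)
apply: dominates_01_reindex (dominates_01_option dom) => j.
have [[t chi_t]|chi1] := EM (exists t, chi j t != 1); last first.
  exists None => t /=; apply/esym/eqP; apply: contrapT => /negP ct.
  by apply: chi1; exists t.
have : is_nonzero_weight rho (chi j).
  split; last by exists t.
  split=> //; exists e`_j => //.
  by apply: (basis_not0 e_basis); rewrite mem_nth ?size_tuple.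
by move=> /(alphaP _).1 [k kP]; exists (Some k).
Qed.

Theorem proposition2p13 (R : realType) (T : algTorus R[i]) (V : vectType R[i])
    (rho : ratModule T V) (n : nat) (alpha : 'I_n -> T -> R[i]) :
  lists_nonzero_weights rho alpha ->
  coreduced rho <-> generated_by_01_solutions alpha.
Proof. exact: coreduced_iff_generated_by_01. Qed.
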